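(* There exists a universal constant $C>0$ such that the following holds. Let $0<\sigma_{\min}\le\sigma_{\max}<\infty$, let $\mathcal{P}=\{f_{\mu,G}:\mu\in\mathbb{R},\ \operatorname{supp}(G)\subseteq[\sigma_{\min},\sigma_{\max}]\}$, and let $\overline P\in\mathcal{P}$. Then for all $0<\varepsilon\le\delta\le\frac18$, $$\log N_{[\,]}(\varepsilon,\mathcal{P}(\overline P,\delta),H)\le C\log^3\!\Big(\frac{\sigma_{\max}}{\varepsilon\sigma_{\min}}\Big)\Big(\log\log\Big(\frac{\sigma_{\max}}{\varepsilon\sigma_{\min}}\Big)\Big)^4.$$
   Context: For $\mu\in\mathbb{R}$ and a probability distribution $G$ on $(0,\infty)$, $f_{\mu,G}(x)=\mathbb{E}_{\sigma\sim G}\big[\frac1\sigma\varphi\big(\frac{x-\mu}{\sigma}\big)\big]$, where $\varphi$ is the standard normal density; distributions are identified with their densities. For (not necessarily probability) positive measures, $H^2(\mu,\nu)=\int(\sqrt{d\mu}-\sqrt{d\nu})^2$. The localized family is $\mathcal{P}(\overline P,\delta)=\{P\in\mathcal{P}:H(P,\overline P)\le\delta\}$. The bracketing number $N_{[\,]}(\varepsilon,\mathcal{Q},H)$ of a class $\mathcal{Q}$ is the smallest integer $N$ such that there exist $N$ brackets of positive measures $[P_1^{\mathrm L},P_1^{\mathrm U}],\dots,[P_N^{\mathrm L},P_N^{\mathrm U}]$ with $\max_i H(P_i^{\mathrm L},P_i^{\mathrm U})\le\varepsilon$ and such that for every $P\in\mathcal{Q}$ there is $i$ with $P_i^{\mathrm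 L}\le P\le P_i^{\mathrm U}$ pointwise. *)

(* Defs.v *)
From HB Require Import structures.
From mathcomp Require Import all_boot all_order all_algebra.
From mathcomp Require Import all_classical all_reals all_analysis.

Set Implicit Arguments.
Unset Strict Implicit.
Unset Printing Implicit Defensive.
Import Order.TTheory GRing.Theory Num.Theory.
Import numFieldNormedType.Exports.

Local Open Scope classical_set_scope.
Local Open Scope ring_scope.

(* Topological support: the points all of whose open neighbourhoods are
   charged by G. *)
Definition supp (R : realType) (G : probability (measurableTypeR R) R) :
    set R :=
  [set x : R | forall U : set R, open U -> U x -> (0 < G U)%E].

(* The density of the scale mixture f_{mu,G}, for G carried by (0, +oo): the
   integrand is total in sigma, its values at sigma <= 0 being G-negligible. *)
Definition scale_mixture (R : realType) (mu : R)
    (G : probability (measurableTypeR R) R) (x : R) : R :=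
  fine 'E_G[fun sigma : R =>
              (sigma^-1 * normal_pdf 0 1 ((x - mu) / sigma))%R]%E.

Definition scale_mixtures (R : realType) (smin smax : R) : set (R -> R) :=
  [set f | exists (mu : R) (G : probability (measurableTypeR R) R),
     [/\ G `]0, +oo[%classic = 1%E,
         supp G `<=` `[smin, smax]%classic &
         f = scale_mixture mu G]].

(* A positive measure is represented by its density with respect to Lebesgue
   measure; its total mass may be infinite. *)
Definition positive_density (R : realType) (f : R -> R) : Prop :=
  measurable_fun [set: R] f /\ forall x, 0 <= f x.

Definition hellinger (R : realType) (f g : R -> R) : \bar R :=
  sqrte (\int[@lebesgue_measure R]_x
           (((Num.sqrt (f x) - Num.sqrt (g x)) ^+ 2)%:E))%E.

Definition localized (R : realType) (Q : set (R -> R)) (f0 : R -> R)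
    (delta : R) : set (R -> R) :=
  [set f | Q f /\ (hellinger f f0 <= delta%:E)%E].

Definition bracket_cover (R : realType) (eps : R) (Q : set (R -> R))
    (n : nat) : Prop :=
  exists L U : 'I_n -> R -> R,
    [/\ forall i, positive_density (L i) /\ positive_density (U i),
        forall i, (hellinger (L i) (U i) <= eps%:E)%E &
        forall f, Q f -> exists i, forall x, L i x <= f x <= U i x].

(* The smallest size of a finite bracket cover, and +oo if there is none. *)
Definition bracketing_number (R : realType) (eps : R) (Q : set (R -> R)) :
    \bar R :=
  ereal_inf [set n%:R%:E | n in bracket_cover eps Q].

(* Main.v *)
Require Import Defs.
From HB Require Import structures.
From mathcomp Require Import all_boot all_order all_algebra.
From mathcomp Require Import all_classical all_reals all_analysis.
From mathcomp Require Import measurable_realfun ring lra.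

(** Write k_s(u) for the N(0, s^2) density at u, let t = b / (a eps) be the ratio
    in the bound, with a, b the extreme scales, and L = ln t.  The reason for
    the bound is that, on the scales s in [a, b] and up to an error that is a
    tiny multiple of the N(0, (2b)^2) density, k_s(u) is a sum of O(L^2)
    products of a function of s and a function of u.

    To see this, cut [a, b] into O(L) pieces v <= s < e v.  For s in such a piece
    and u^2 <= 192 L v^2 the exponent (u / s)^2 / 2 is O(L), so that O(L) terms
    of the exponential series leave an error that is a negative power of t, and
    (u / s)^2 = (v / s)^2 (u / v)^2 separates the variables in every term.  For
    larger u the kernel itself is below the error envelope.  This is
    [kernel_expansion].

    Averaging over s, the density f_{mu,G} at x is, up to the same error, a fixed
    linear combination of functions of x - mu whose coefficients are O(L^2)
    averages of G, all in [0, 1].  Rounding each of them to precision t^-O(1)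
    leaves t^O(1) possible values, and mu can be moved to a grid of mesh
    t^-O(1) b ([gauss_kernel_shift]).  The grid needs only t^O(1) points, because a
    Hellinger distance of 1/8 forces |mu - mu0| <= 8 L b: beyond that distance
    the two densities would be almost mutually singular
    ([localized_location]).  The number N of approximants thus satisfies
    ln N = O(L^2) O(L) = O(L^3).

    Subtracting from and adding to each approximant its error envelope, a
    multiple of a normal density, gives a bracket [l, u] with
    H(l, u)^2 <= \int (u - l) <= eps^2 ([bracket_cover_of_approx]).  Since
    t >= 8, ln L stays away from 0, so that L^3 is at most a constant times
    L^3 (ln L)^4. *)

Set Implicit Arguments.
Unset Strict Implicit.
Unset Printing Implicit Defensive.
Import Order.TTheory GRing.Theory Num.Theory.
Import numFieldNormedType.Exports.

Local Open Scope classical_set_scope.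
Local Open Scope ring_scope.

(** * Exponential estimates *)

Lemma expR_half_le2 (R : realType) : expR (2^-1 : R) <= 2.
Proof.
have h : 2^-1 <= expR (- 2^-1 : R) by apply: le_trans (expR_ge1Dx _); lra.
by rewrite -(invrK (expR _)) -expRN -[leRHS]invrK lef_pV2 // posrE ?invr_gt0 ?expR_gt0.
Qed.

Lemma expR1_le4 (R : realType) : expR (1 : R) <= 4.
Proof.
rewrite (_ : expR 1 = expR (2^-1 + 2^-1 : R)); last by congr expR; lra.
rewrite expRD (_ : 4 = 2 * 2 :> R); last by lra.
by apply: ler_pM; rewrite ?expR_ge0 ?expR_half_le2.
Qed.

(** For j >= n and c = e the j-th term of the series at |x| is at most c^-n times
    the j-th term at c |x|; hence the tail is at most c^-n exp(c |x|), and c <= 4.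
    The gain exp(-n) is what makes O(L) terms enough for a precision exp(-O(L))
    on |x| = O(L). *)
Lemma expR_taylor_tail (R : realType) (n : nat) (x : R) :
  `|expR x - \sum_(j < n) x ^+ j / j`!%:R| <= expR (4 * `|x| - n%:R).
Proof.
have cx := is_cvg_series_exp_coeff x.
pose c : R := expR 1.
have tail N : (n <= N)%N ->
    `|series (exp_coeff x) N - \sum_(j < n) x ^+ j / j`!%:R| <= expR (4 * `|x| - n%:R).
  move=> nN; rewrite /series /= (big_cat_nat _ (n := n))//= big_mkord.
  rewrite (addrC (\sum_(i < n) _)) addrK.
  apply: (le_trans (ler_norm_sum _ _ _)).
  apply: (@le_trans _ _ (expR (- n%:R) * \sum_(n <= j < N) exp_coeff (c * `|x|) j)).
    rewrite mulr_sumr !big_nat; apply: ler_sum => j /andP[nj _].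
    rewrite /exp_coeff /= normrM normrX (@ger0_norm _ (_^-1))// mulrA.
    apply: ler_wpM2r => //; rewrite exprMn mulrA ler_peMl ?exprn_ge0//.
    rewrite -expRM_natl mulr1 -expRD -[leLHS]expR0 ler_expR addrC subr_ge0.
    by rewrite ler_nat.
  rewrite addrC expRD; apply: ler_wpM2l; first exact: expR_ge0.
  apply: (@le_trans _ _ (expR (c * `|x|))); last first.
    by rewrite ler_expR ler_wpM2r// expR1_le4.
  apply: (@le_trans _ _ (series (exp_coeff (c * `|x|)) N)).
    rewrite /series /= [leRHS](big_cat_nat _ (n := n))//= lerDr.
    by apply: sumr_ge0 => i _; rewrite exp_coeff_ge0 ?mulr_ge0 ?expR_ge0.
  apply: nondecreasing_cvgn_le; last exact: is_cvg_series_exp_coeff.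
  by apply: nondecreasing_series => i _ _; rewrite exp_coeff_ge0 ?mulr_ge0 ?expR_ge0.
have cv : series (exp_coeff x) N - \sum_(j < n) x ^+ j / j`!%:R @[N --> \oo]
    --> expR x - \sum_(j < n) x ^+ j / j`!%:R.
  by apply: cvgB; [exact: cx | exact: cvg_cst].
have cn : `|series (exp_coeff x) N - \sum_(j < n) x ^+ j / j`!%:R| @[N --> \oo]
    --> `|expR x - \sum_(j < n) x ^+ j / j`!%:R| by apply: cvg_norm.
rewrite -(cvg_lim _ cn)//; apply: limr_le; first by apply/cvg_ex; eexists; exact: cn.
by exists n => // N /= nN; exact: tail.
Qed.

Lemma expRN_dist_le (R : realType) (p q m : R) : m <= p -> m <= q ->
  `|expR (- p) - expR (- q)| <= `|p - q| * expR (- m).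
Proof.
wlog pq : p q / p <= q.
  move=> H mp mq; have [pq|/ltW qp] := leP p q; first exact: H.
  by rewrite distrC (distrC p); apply: H.
move=> mp mq; rewrite ger0_norm ?subr_ge0 ?ler_expR ?lerN2//.
rewrite ler0_norm ?subr_le0// opprB.
have -> : - q = - p + (p - q) by lra.
rewrite expRD -[X in X - _]mulr1 -mulrBr mulrC.
apply: ler_pM; rewrite ?expR_ge0 ?ler_expR ?lerN2// ?subr_ge0.
- by rewrite -[leRHS]expR0 ler_expR; lra.
- by have := expR_ge1Dx (p - q); lra.
Qed.

(** The exponents differ by at most r (|w| + 1/2), and the smaller one is at least
    w^2 / 4 - 1/2; half of that decay pays for the factor |w| + 1/2, the other half
    is left as the envelope. *)
Lemma gaussian_shift (R : realType) (w d r : R) : `|d| <= r -> r <= 1 ->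
  `|expR (- ((w - d) ^+ 2 / 2)) - expR (- (w ^+ 2 / 2))|
   <= 8 * r * expR (- (w ^+ 2 / 8)).
Proof.
move=> dr r1; have r0 : 0 <= r by apply: le_trans dr.
have [d1 d2] : - r <= d /\ d <= r by apply/andP; rewrite -ler_norml.
have d2r : d ^+ 2 <= r ^+ 2 by rewrite -real_normK ?num_real// lerXn2r// nnegrE.
have r2 : r ^+ 2 <= r by nra.
apply: (le_trans (@expRN_dist_le _ _ _ (w ^+ 2 / 4 - 2^-1) _ _)).
- have := sqr_ge0 (w / 2 - d); have := sqr_ge0 (w - 2 * d); nra.
- have := sqr_ge0 w; nra.
have wE : w ^+ 2 = `|w| ^+ 2 by rewrite real_normK ?num_real.
have hd : `|(w - d) ^+ 2 / 2 - w ^+ 2 / 2| <= r * (`|w| + 2^-1).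
  have -> : (w - d) ^+ 2 / 2 - w ^+ 2 / 2 = d ^+ 2 / 2 - d * w by field.
  apply: (le_trans (ler_normB _ _));
  rewrite [X in X + _]ger0_norm ?divr_ge0 ?sqr_ge0// normrM.
  have : `|d| * `|w| <= r * `|w| by apply: ler_wpM2r.
  by lra.
have hw : `|w| + 2^-1 <= 4 * expR (w ^+ 2 / 8).
  have := expR_ge1Dx (w ^+ 2 / 8); have := sqr_ge0 (`|w| - 1); rewrite wE; nra.
apply: (le_trans (ler_wpM2r (expR_ge0 _) hd)).
apply: (le_trans (ler_wpM2r (expR_ge0 _) (ler_wpM2l r0 hw))).
have -> : - (w ^+ 2 / 4 - 2^-1) = - (w ^+ 2 / 8) + (- (w ^+ 2 / 8)) + 2^-1 by field.
rewrite !expRD.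
have e0 := expR_gt0 (- (w ^+ 2 / 8)).
have := @expR_half_le2 R.
have := expR_gt0 (w ^+ 2 / 8).
have : expR (w ^+ 2 / 8) * expR (- (w ^+ 2 / 8)) = 1 by rewrite -expRD subrr expR0.
set A := expR (w ^+ 2 / 8); set B := expR _; set H := expR _ => AB A0 H2.
have -> : r * (4 * A) * (B * B * H) = r * 4 * (A * B) * B * H by ring.
rewrite AB mulr1 [8 * r](_ : _ = r * 4 * 2); last by ring.
rewrite -!mulrA; do 2 apply: ler_wpM2l => //.
by rewrite mulrC; apply: ler_wpM2r H2; exact: ltW.
Qed.

(** * Separated expansion of the Gaussian kernel *)

(** The N(0, s^2) density at u without the factor 1 / sqrt (2 pi), which is common
    to all scales. *)
Definition gauss_kernel (R : realType) (s u : R) : R :=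
  s^-1 * expR (- ((u / s) ^+ 2 / 2)).

Lemma gauss_kernel_ge0 (R : realType) (s u : R) : 0 < s -> 0 <= gauss_kernel s u.
Proof. by move=> s0; rewrite mulr_ge0 ?expR_ge0// invr_ge0 ltW. Qed.

Lemma gauss_kernel_double (R : realType) (b u : R) : b != 0 ->
  gauss_kernel (2 * b) u = (2 * b)^-1 * expR (- ((u / b) ^+ 2 / 8)).
Proof. by move=> b0; rewrite /gauss_kernel; congr (_ * expR _); field. Qed.

Lemma sqr_div_le (R : realType) (s b u : R) : 0 < s -> s <= b ->
  (u / b) ^+ 2 <= (u / s) ^+ 2.
Proof.
move=> s0 sb; rewrite !expr_div_n ler_wpM2l ?sqr_ge0//
  lef_pV2 ?posrE ?exprn_gt0//; last exact: lt_le_trans sb.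
by rewrite lerXn2r ?nnegrE ?(ltW s0)// (le_trans _ sb)// ltW.
Qed.

(** Errors are always compared with the kernel of scale 2b, which dominates every
    factor exp(-(u / s)^2 / 8) with s <= b.  The bound z <= q a / (2b) absorbs the
    ratio of the normalizing factors 1 / s and 1 / (2b). *)
Lemma gauss_kernel_le_wide (R : realType) (a b s u q z y : R) :
  0 < a -> a <= s -> s <= b -> 0 <= q ->
  z <= q * a / (2 * b) -> 0 <= y -> y <= expR (- ((u / b) ^+ 2 / 8)) ->
  s^-1 * (z * y) <= q * gauss_kernel (2 * b) u.
Proof.
move=> a0 as_ sb q0 zq y0 yb.
have s0 : 0 < s by apply: lt_le_trans as_.
have b0 : 0 < b by apply: lt_le_trans sb.
rewrite gauss_kernel_double ?gt_eqF// !mulrA.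
apply: (@le_trans _ _ (s^-1 * (q * a / (2 * b)) * y)).
  by rewrite ler_wpM2r// ler_wpM2l// invr_ge0 ltW.
have -> : s^-1 * (q * a / (2 * b)) * y = (a / s) * (q / (2 * b) * y).
  by field; rewrite !gt_eqF.
have qb : 0 <= q / (2 * b) by rewrite divr_ge0// mulr_ge0// ltW.
apply: (@le_trans _ _ (1 * (q / (2 * b) * y))).
  by apply: ler_wpM2r; [exact: mulr_ge0 | rewrite ler_pdivrMr// mul1r].
by rewrite mul1r ler_wpM2l.
Qed.

(** Of the exponent (u / s)^2 / 2, one quarter is kept for the envelope, and the
    other three quarters make the factor exp(-4L). *)
Lemma gauss_kernel_tail (R : realType) (a b s u q L : R) :
  0 < a -> a <= s -> s <= b -> 0 <= q -> expR (- (4 * L)) <= q * a / (2 * b) ->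
  4 * L <= 3 / 8 * (u / s) ^+ 2 ->
  gauss_kernel s u <= q * gauss_kernel (2 * b) u.
Proof.
move=> a0 as_ sb q0 key Lu; rewrite /gauss_kernel.
have s0 : 0 < s by apply: lt_le_trans as_.
have -> : - ((u / s) ^+ 2 / 2) = - (3 / 8 * (u / s) ^+ 2) + - ((u / s) ^+ 2 / 8).
  by field; rewrite gt_eqF.
rewrite expRD; apply: (gauss_kernel_le_wide a0 as_ sb q0); rewrite ?expR_ge0//.
  by apply: le_trans key; rewrite ler_expR lerN2.
by rewrite ler_expR lerN2 ler_wpM2r// sqr_div_le.
Qed.

(** The exponent (u / s)^2 / 2 is at most 96 L, so that the remainder of the series
    is at most exp(384 L - n) <= exp(-28 L), and 28 = 4 + 192 / 8: the factor
    exp(-4L) gives q, and exp(-24 L) is below the envelope on this range of u. *)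
Lemma gauss_kernel_taylor (R : realType) (a b s t u q L : R) (n : nat) :
  0 < a -> a <= s -> s <= b -> 0 <= q -> expR (- (4 * L)) <= q * a / (2 * b) ->
  0 < t -> t <= s -> u ^+ 2 <= 192 * L * t ^+ 2 -> 412 * L <= n%:R ->
  `|gauss_kernel s u
    - \sum_(j < n) (t / s) ^+ (2 * j).+1
                    * (t^-1 * ((- ((u / t) ^+ 2 / 2)) ^+ j / j`!%:R))|
   <= q * gauss_kernel (2 * b) u.
Proof.
move=> a0 as_ sb q0 key t0 ts uL Ln; rewrite /gauss_kernel.
have s0 : 0 < s by apply: lt_le_trans as_.
have b0 : 0 < b by apply: lt_le_trans sb.
rewrite (eq_bigr (fun j : 'I_n =>
  s^-1 * ((- ((u / s) ^+ 2 / 2)) ^+ j / j`!%:R))); last first.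
  move=> j _; rewrite [(t / s) ^+ _]exprS exprM.
  have -> : - ((u / s) ^+ 2 / 2) = (t / s) ^+ 2 * (- ((u / t) ^+ 2 / 2)).
    by field; rewrite !gt_eqF.
  rewrite [(_ * - _) ^+ j]exprMn.
  have aux (A B C : R) : t / s * A * (t^-1 * (B * C)) = s^-1 * (A * B * C).
    by field; rewrite !gt_eqF.
  exact: aux.
rewrite -mulr_sumr -mulrBr normrM gtr0_norm ?invr_gt0//.
have yL : (u / s) ^+ 2 <= 192 * L.
  apply: (le_trans (sqr_div_le u t0 ts)).
  by rewrite expr_div_n ler_pdivrMr// exprn_gt0.
apply: (@le_trans _ _ (s^-1 * (expR (- (4 * L)) * expR (- (24 * L))))).
  rewrite ler_wpM2l ?invr_ge0 ?(ltW s0)//.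
  apply: (le_trans (expR_taylor_tail _ _)).
  rewrite -expRD ler_expR normrN ger0_norm; last by rewrite divr_ge0// sqr_ge0.
  by lra.
apply: (gauss_kernel_le_wide a0 as_ sb q0); rewrite ?expR_ge0//.
rewrite ler_expR; have := sqr_div_le u s0 sb; lra.
Qed.

(** In units of s the shift is at most h / s <= h / a, so the relative mesh
    h / b only needs to be of order q (a / b)^2. *)
Lemma gauss_kernel_shift (R : realType) (a b s u d h q : R) :
  0 < a -> a <= s -> s <= b -> 0 <= q -> q <= 1 ->
  16 * b * h <= q * a ^+ 2 -> `|d| <= h ->
  `|gauss_kernel s (u - d) - gauss_kernel s u| <= q * gauss_kernel (2 * b) u.
Proof.
move=> a0 as_ sb q0 q1 hh dh; rewrite /gauss_kernel.
have s0 : 0 < s by apply: lt_le_trans as_.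
have b0 : 0 < b by apply: lt_le_trans sb.
have h0 : 0 <= h by apply: le_trans dh.
rewrite -mulrBr normrM gtr0_norm ?invr_gt0// mulrBl.
have hs : 16 * b * h <= q * s ^+ 2.
  by apply: (le_trans hh); rewrite ler_wpM2l// lerXn2r// nnegrE ltW.
have r1 : h / s <= 1.
  rewrite ler_pdivrMr// mul1r.
  have : 16 * b * h <= 1 * (b * s).
    apply: (le_trans hs); apply: ler_pM => //; first exact: sqr_ge0.
    by rewrite expr2 ler_wpM2r// ltW.
  rewrite mul1r -mulrA mulrCA ler_pM2l//; lra.
have dr : `|d / s| <= h / s.
  by rewrite normrM normfV (gtr0_norm s0) ler_wpM2r// invr_ge0 ltW.
apply: (@le_trans _ _ (s^-1 * (8 * (h / s) * expR (- ((u / s) ^+ 2 / 8))))).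
  by rewrite ler_wpM2l ?invr_ge0 ?(ltW s0)//; exact: gaussian_shift.
rewrite -/(gauss_kernel (2 * b) u) gauss_kernel_double ?gt_eqF// !mulrA.
apply: ler_pM; rewrite ?expR_ge0 ?mulr_ge0 ?invr_ge0 ?(ltW s0)//; last first.
  by rewrite ler_expR lerN2 ler_wpM2r// sqr_div_le.
have -> : s^-1 * 8 * h / s = (16 * b * h) / (s ^+ 2 * (2 * b)).
  by field; rewrite !gt_eqF.
rewrite ler_pdivrMr; last by rewrite mulr_gt0 ?exprn_gt0 ?mulr_gt0.
have -> : q / (2 * b) * (s ^+ 2 * (2 * b)) = q * s ^+ 2 by field; rewrite gt_eqF.
by [].
Qed.

(** The factors of the j-th term of the expansion on the piece
    v <= s < e v with v = a e^k.  Normalizing s by the left end v keeps the powers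
    of v / s in [0, 1]. *)
Definition scale_coef (R : realType) (a : R) (k j : nat) (s : R) : R :=
  \1_`[a * expR k%:R, a * expR k.+1%:R[%classic s
  * (a * expR k%:R / s) ^+ (2 * j).+1.

Definition taylor_atom (R : realType) (w a : R) (k j : nat) (u : R) : R :=
  if u ^+ 2 <= w * (a * expR k%:R) ^+ 2
  then (a * expR k%:R)^-1 * ((- ((u / (a * expR k%:R)) ^+ 2 / 2)) ^+ j / j`!%:R)
  else 0.

Lemma scale_coef_itv (R : realType) (a s : R) (k j : nat) : 0 < a ->
  0 <= scale_coef a k j s <= 1.
Proof.
move=> a0; rewrite /scale_coef indicE.
case: (boolP (s \in _)); rewrite ?mul0r ?ler01 ?lexx//.
rewrite inE/= in_itv/= mul1r => /andP[ts _].
have t0 : 0 < a * expR k%:R by rewrite mulr_gt0 ?expR_gt0.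
have s0 : 0 < s by apply: lt_le_trans ts.
apply/andP; split; first by rewrite exprn_ge0// divr_ge0// ltW.
by apply: exprn_ile1; [rewrite divr_ge0// ltW|rewrite ler_pdivrMr// mul1r].
Qed.

Definition scale_pieces (R : realType) (a b : R) : nat :=
  (Num.truncn (ln (b / a))).+1.

(** Only the piece that contains s contributes.  On it the series is used below the
    cut-off; beyond the cut-off both the sum and the kernel are negligible, since
    s <= 4v gives (u / s)^2 >= 12 L there. *)
Lemma kernel_expansion (R : realType) (a b s u q L : R) (n : nat) :
  0 < a -> a <= s -> s <= b -> 0 <= q -> 0 <= L ->
  expR (- (4 * L)) <= q * a / (2 * b) -> 412 * L <= n%:R ->
  `|gauss_kernel s u
    - \sum_(k < scale_pieces a b) \sum_(j < n)
        scale_coef a k j s * taylor_atom (192 * L) a k j u|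
   <= q * gauss_kernel (2 * b) u.
Proof.
move=> a0 as_ sb q0 L0 key Ln.
have s0 : 0 < s by apply: lt_le_trans as_.
have b0 : 0 < b by apply: lt_le_trans sb.
have sa1 : 1 <= s / a by rewrite ler_pdivlMr// mul1r.
have sa0 : 0 < s / a by rewrite divr_gt0.
pose k0 := Num.truncn (ln (s / a)).
have k0le : (k0 < scale_pieces a b)%N.
  rewrite ltnS; apply: le_truncn.
  by rewrite ler_ln ?posrE ?divr_gt0// ler_wpM2r// invr_ge0 ltW.
have /andP[k1 k2] : k0%:R <= ln (s / a) < k0.+1%:R.
  by apply: truncn_itv; exact: ln_ge0.
have I1 : a * expR k0%:R <= s.
  by rewrite mulrC -ler_pdivlMr// -[leRHS]lnK ?posrE// ler_expR.
have I2 : s < a * expR k0.+1%:R.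
  by rewrite mulrC -ltr_pdivrMr// -[ltLHS]lnK ?posrE// ltr_expR.
rewrite (bigD1 (Ordinal k0le))//= [X in _ - (_ + X)]big1 ?addr0; last first.
  move=> k /eqP kk; apply: big1 => j _; rewrite /scale_coef indicE.
  suff -> : (s \in `[a * expR k%:R, a * expR k.+1%:R[%classic) = false.
    by rewrite !mul0r.
  apply/negbTE/negP; rewrite inE/= in_itv/= => /andP[J1 J2].
  apply: kk; apply/val_inj => /=.
  have E1 : (k < k0.+1)%N.
    by have := le_lt_trans J1 I2; rewrite ltr_pM2l// ltr_expR ltr_nat.
  have E2 : (k0 < k.+1)%N.
    by have := le_lt_trans I1 J2; rewrite ltr_pM2l// ltr_expR ltr_nat.
  by apply/eqP; rewrite eqn_leq; apply/andP; split; rewrite -ltnS.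
have t0 : 0 < a * expR k0%:R by rewrite mulr_gt0 ?expR_gt0.
have [uL|uL] := leP (u ^+ 2) (192 * L * (a * expR k0%:R) ^+ 2).
  rewrite (eq_bigr (fun j : 'I_n => (a * expR k0%:R / s) ^+ (2 * j).+1 *
    ((a * expR k0%:R)^-1 * ((- ((u / (a * expR k0%:R)) ^+ 2 / 2)) ^+ j / j`!%:R)))).
    exact: (gauss_kernel_taylor a0 as_ sb q0 key).
  move=> j _; rewrite /scale_coef /taylor_atom uL indicE mem_set ?mul1r//=.
  by rewrite in_itv/= I1 I2.
rewrite big1 ?subr0; last by move=> j _; rewrite /taylor_atom leNgt uL mulr0.
rewrite ger0_norm ?gauss_kernel_ge0//.
apply: (gauss_kernel_tail a0 as_ sb q0 key).
have I3 : s <= 4 * (a * expR k0%:R).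
  apply: (le_trans (ltW I2)); rewrite -natr1 expRD mulrA [leLHS]mulrC.
  by apply: ler_wpM2r; [exact: ltW | exact: expR1_le4].
have s2 : s ^+ 2 <= 16 * (a * expR k0%:R) ^+ 2.
  have -> : 16 * (a * expR k0%:R) ^+ 2 = (4 * (a * expR k0%:R)) ^+ 2 by ring.
  by rewrite lerXn2r// nnegrE ?mulr_ge0// ltW.
rewrite expr_div_n mulrA ler_pdivlMr ?exprn_gt0//.
have : L * s ^+ 2 <= L * (16 * (a * expR k0%:R) ^+ 2) by rewrite ler_wpM2l.
nra.
Qed.

(** The atoms of one piece are the terms of the exponential series of
    (u / v)^2 / 2 <= 96 L, so they sum to at most exp(96 L) / v.  Hence knowing the
    coefficients to precision 1 / m, with m at least exp(124 L) per piece, determines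
    the expansion up to exp(-28 L) / a, which is below the envelope. *)
Lemma taylor_atom_sum (R : realType) (a b u q L : R) (n : nat) (m : R) :
  0 < a -> a <= b -> 0 <= q -> 0 <= L ->
  expR (- (4 * L)) <= q * a / (2 * b) ->
  (scale_pieces a b)%:R * expR (124 * L) <= m ->
  m^-1 * \sum_(k < scale_pieces a b) \sum_(j < n)
     `|taylor_atom (192 * L) a k j u| <= q * gauss_kernel (2 * b) u.
Proof.
move=> a0 ab q0 L0 key hm.
have b0 : 0 < b by apply: lt_le_trans ab.
have ba1 : 1 <= b / a by rewrite ler_pdivlMr// mul1r.
set K := scale_pieces a b in hm *.
have m0 : 0 < m by apply: lt_le_trans hm; rewrite mulr_gt0 ?expR_gt0// ltr0n.
have tb k : (k < K)%N -> a * expR k%:R <= b.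
  move=> kK; rewrite mulrC -ler_pdivlMr// -[leRHS]lnK ?posrE ?divr_gt0// ler_expR.
  apply: (@le_trans _ _ (Num.truncn (ln (b / a)))%:R); first by rewrite ler_nat.
  by rewrite truncn_le// ln_ge0.
have [uL|uL] := leP (u ^+ 2) (192 * L * b ^+ 2); last first.
  rewrite big1 => [|k _].
    by rewrite mulr0; apply: mulr_ge0 => //; apply: gauss_kernel_ge0; rewrite mulr_gt0.
  apply: big1 => j _; rewrite /taylor_atom ifF ?normr0//; apply/negbTE; rewrite -ltNge.
  apply: le_lt_trans uL; rewrite ler_wpM2l ?mulr_ge0// lerXn2r// ?nnegrE ?(ltW b0)//.
    by rewrite mulr_ge0 ?expR_ge0 // ltW.
  exact: tb.
have inner (k : 'I_K) :
    \sum_(j < n) `|taylor_atom (192 * L) a k j u| <= a^-1 * expR (96 * L).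
  set t := a * expR k%:R.
  have t0 : 0 < t by rewrite mulr_gt0 ?expR_gt0.
  rewrite /taylor_atom -/t; have [ut|_] := boolP (u ^+ 2 <= 192 * L * t ^+ 2); last first.
    by rewrite big1 ?mulr_ge0 ?expR_ge0 ?invr_ge0 ?(ltW a0)// => j _; rewrite normr0.
  pose z := (u / t) ^+ 2 / 2.
  have z0 : 0 <= z by rewrite divr_ge0// sqr_ge0.
  rewrite (eq_bigr (fun j : 'I_n => t^-1 * exp_coeff z j)); last first.
    move=> j _; rewrite normrM gtr0_norm ?invr_gt0// normrM normrX normrN.
    by rewrite -/z (ger0_norm z0) ger0_norm.
  rewrite -mulr_sumr; apply: ler_pM.
  - by rewrite invr_ge0 ltW.
  - by apply: sumr_ge0 => j _; exact: exp_coeff_ge0.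
  - by rewrite lef_pV2 ?posrE// ler_peMr ?(ltW a0)// -[leLHS]expR0 ler_expR.
  - apply: (@le_trans _ _ (expR z)).
      have := @nondecreasing_cvgn_le _ (series (exp_coeff z)) _
        (is_cvg_series_exp_coeff z) n.
      rewrite /series/= big_mkord; apply.
      by apply: nondecreasing_series => i _ _; exact: exp_coeff_ge0.
    rewrite ler_expR /z expr_div_n.
    have : u ^+ 2 / t ^+ 2 <= 192 * L by rewrite ler_pdivrMr ?exprn_gt0.
    lra.
apply: (@le_trans _ _ (m^-1 * (K%:R * (a^-1 * expR (96 * L))))).
  rewrite ler_wpM2l ?invr_ge0 ?(ltW m0)//.
  apply: (@le_trans _ _ (\sum_(k < K) a^-1 * expR (96 * L))).
    by apply: ler_sum => k _; exact: inner.
  by rewrite sumr_const card_ord [leRHS]mulr_natl.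
have -> : m^-1 * (K%:R * (a^-1 * expR (96 * L))) =
    a^-1 * (m^-1 * (K%:R * expR (124 * L)) * expR (- (28 * L))).
  have -> : 96 * L = 124 * L + - (28 * L) by ring.
  by rewrite expRD; ring.
apply: (@le_trans _ _ (a^-1 * (expR (- (4 * L)) * expR (- (24 * L))))).
  rewrite ler_wpM2l ?invr_ge0 ?(ltW a0)// -expRD.
  have -> : - (4 * L) + - (24 * L) = - (28 * L) by ring.
  rewrite ler_piMl ?expR_ge0//.
  by rewrite mulrC ler_pdivrMr// mul1r.
apply: (gauss_kernel_le_wide a0 (lexx _) ab q0); rewrite ?expR_ge0//.
rewrite ler_expR expr_div_n.
have : u ^+ 2 / b ^+ 2 <= 192 * L by rewrite ler_pdivrMr ?exprn_gt0.
lra.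
Qed.

(** * Averages over the mixing distribution *)

(** By definition every point off the support has a null neighbourhood.  One of the
    countably many balls with rational centre and radius 1 / (m + 1) fits between
    the point and that neighbourhood, so the complement of the support is covered
    by countably many null balls. *)
Lemma supp_negligible (R : realType) (G : probability (measurableTypeR R) R) :
  G.-negligible (~` supp G).
Proof.
pose B (p : rat * nat) : set (measurableTypeR R) :=
  ball (ratr p.1 : R) (p.2.+1%:R^-1).
pose F (i : nat) : set (measurableTypeR R) :=
  if @unpickle (rat * nat)%type i is Some p then
  (if `[< G (B p) = 0%E >] then B p else set0) else set0.
have mB p : measurable (B p) by apply: open_measurable; exact: ball_open.
suff sF : ~` supp G `<=` \bigcup_i F i.
  have [N [mN N0 FN]] : G.-negligible (\bigcup_i F i).
    apply: negligible_bigcup => i; rewrite /F.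
    case: unpickle => [p|]; last exact: negligible_set0.
    by case: asboolP => [B0|_]; [exact/negligibleP|exact: negligible_set0].
  by exists N; split => //; exact: subset_trans FN.
move=> x /= xG.
have [U [oU Ux GU0]] : exists U : set R, [/\ open U, U x & G U = 0%E].
  apply: contrapT => H; apply: xG => U oU Ux.
  rewrite lt_neqAle measure_ge0 andbT; apply/eqP => GU; apply: H.
  by exists U.
have [e /= e0 eU] : exists2 e : R, 0 < e & ball x e `<=` U.
  by apply/nbhs_ballP; exact: open_nbhs_nbhs.
have e20 : 0 < e / 2 by rewrite divr_gt0.
have [m me] : exists m : nat, m.+1%:R^-1 < e / 2.
  exists (Num.truncn (e / 2)^-1); rewrite -[ltRHS]invrK ltf_pV2 ?posrE ?invr_gt0//.
  exact: truncnS_gt.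
have m0 : 0 < m.+1%:R^-1 :> R by rewrite invr_gt0 ltr0n.
pose c : R := m.+1%:R^-1; rewrite -/c in me m0.
have xx : x - c < x + c by lra.
have [p /[!in_itv]/= /andP[p1 p2]] := rat_in_itvoo xx.
have [i iE] : exists i, @unpickle (rat * nat)%type i = Some (p, m).
  by exists (pickle (p, m)); rewrite pickleK.
have BE y : B (p, m) y = (`|ratr p - y| < c) by [].
exists i; first exact: I.
have xB : B (p, m) x by rewrite BE ltr_distlC; apply/andP; split; lra.
rewrite /F iE; case: asboolP => // BN0; exfalso; apply: BN0.
apply/eqP; rewrite eq_le measure_ge0 andbT -GU0; apply: le_measure; rewrite ?inE//.
  exact: open_measurable.
apply: subset_trans eU => y; rewrite BE /ball/= !ltr_distlC => /andP[y1 y2].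
by apply/andP; split; lra.
Qed.

Lemma measurable_invr (R : realType) : measurable_fun [set: R] (@GRing.inv R).
Proof.
have -> : [set: R] = [set 0] `|` [set~ 0] by rewrite setUv.
apply/measurable_funU; [by []|exact: measurableC|split].
  exact: measurable_fun_set1.
apply: open_continuous_measurable_fun.
  by apply: closed_openC; exact: closed_eq.
by move=> x /set_mem/= /eqP x0; exact: inv_continuous.
Qed.

Lemma normal_pdf01E (R : realType) (s u : R) :
  s^-1 * normal_pdf 0 1 (u / s) = normal_peak 1 * gauss_kernel s u.
Proof.
rewrite normal_pdfE ?oner_neq0// /normal_fun /gauss_kernel subr0 expr1n mulrCA.
by rewrite mulNr.
Qed.

Lemma normal_pdf_gauss_kernel (R : realType) (m s x : R) : 0 < s ->
  normal_pdf m s x = normal_peak 1 * gauss_kernel s (x - m).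
Proof.
move=> s0; rewrite normal_pdfE ?gt_eqF// /normal_fun /gauss_kernel mulrA.
congr (_ * expR _).
  rewrite /normal_peak expr1n mul1r -mulrnAr sqrtrM ?sqr_ge0// sqrtr_sqr gtr0_norm//.
  by rewrite invfM mulrC.
by rewrite expr_div_n mulNr -mulr_natr; field; rewrite gt_eqF.
Qed.

Lemma measurable_gauss_kernel d (T : measurableType d) (R : realType) (f g : T -> R) :
  measurable_fun setT f -> measurable_fun setT g ->
  measurable_fun setT (fun t => gauss_kernel (f t) (g t)).
Proof.
move=> mf mg; have mi : measurable_fun setT (fun t => (f t)^-1).
  by apply: measurableT_comp mf; exact: measurable_invr.
apply: measurable_funM => //; apply: measurableT_comp; first exact: measurable_expR.
apply: measurableT_comp => //; apply: measurable_funM => //.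
by apply: measurable_funX; exact: measurable_funM.
Qed.

Lemma measurable_normal_kernel (R : realType) (u : R) :
  measurable_fun setT (fun s : R => normal_peak 1 * gauss_kernel s u).
Proof.
apply: measurable_funM => //.
exact: (@measurable_gauss_kernel _ _ R (fun s => s) (fun=> u)).
Qed.

Section mixture.
Variables (R : realType) (a b : R) (G : probability (measurableTypeR R) R).
Hypotheses (a0 : 0 < a) (ab : a <= b) (Gab : supp G `<=` `[a, b]%classic).

Let D : set R := `[a, b]%classic.
Let D0 s : D s -> 0 < s.
Proof. by rewrite /D/= in_itv/= => /andP[+ _]; exact: lt_le_trans. Qed.

Let GDC : G (~` D) = 0%E.
Proof.
have [N [mN N0 FN]] := supp_negligible G.
apply/eqP; rewrite eq_le measure_ge0 andbT -N0; apply: le_measure; rewrite ?inE//.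
  by apply: measurableC; exact: measurable_itv.
by apply: subset_trans FN; exact: subsetC.
Qed.

Let GD : G D = 1%E.
Proof.
have := @probability_setC _ _ _ G (~` D) (measurableC (measurable_itv _)).
by rewrite setCK GDC sube0.
Qed.

(** The mean of g under G over the scales in [a, b], where the kernels are bounded;
    for G carried by [a, b] it is the mean of g under G. *)
Definition mixture_mean (g : R -> R) : R := \int[G]_s (\1_D s * g s).

Lemma integrable_restrict_bounded (g : R -> R) (c : R) :
  measurable_fun setT g -> (forall s, D s -> `|g s| <= c) ->
  G.-integrable setT (EFin \o (fun s => \1_D s * g s)).
Proof.
move=> mg gc; apply: measurable_bounded_integrable => //.
- by rewrite [X in (X < _)%E](@probability_setT _ _ _ G) ltry.
- by apply: measurable_funM => //; apply: measurable_indic; exact: measurable_itv.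
exists c; split; first exact: num_real.
move=> x cx s _ /=; rewrite indicE; case: (boolP (s \in D)) => [/set_mem Ds|_].
  by rewrite mul1r (le_trans (gc s Ds))// ltW.
rewrite mul0r normr0; apply: ltW; apply: le_lt_trans cx.
have Da : D a by rewrite /D/= in_itv/= lexx.
exact: le_trans (gc a Da).
Qed.

Lemma mixture_mean_dist (g h : R -> R) (cg ch e : R) :
  measurable_fun setT g -> (forall s, D s -> `|g s| <= cg) ->
  measurable_fun setT h -> (forall s, D s -> `|h s| <= ch) ->
  0 <= e -> (forall s, D s -> `|g s - h s| <= e) ->
  `|mixture_mean g - mixture_mean h| <= e.
Proof.
move=> mg bg mh bh e0 gh.
have ig := integrable_restrict_bounded mg bg.
have ih := integrable_restrict_bounded mh bh.
have ie : G.-integrable setT (EFin \o (fun=> e)).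
  by apply: finite_measure_integrable_cst.
have igh : G.-integrable setT (EFin \o (fun s => \1_D s * g s - \1_D s * h s)).
  exact: (integrableB measurableT ig ih).
rewrite /mixture_mean -RintegralB//.
apply: (le_trans (le_normr_Rintegral _ igh)) => //.
have -> : e = \int[G]_s (cst e s).
  by rewrite Rintegral_cst//= probability_setT mulr1.
apply: le_Rintegral => //.
  exact: integrable_norm.
move=> s _ /=; rewrite -mulrBr indicE; case: (boolP (s \in D)) => [/set_mem Ds|_].
  by rewrite mul1r gh.
by rewrite mul0r normr0.
Qed.

Lemma mixture_mean_norm_le (g : R -> R) (e : R) :
  measurable_fun setT g -> (forall s, D s -> `|g s| <= e) ->
  `|mixture_mean g| <= e.
Proof.
move=> mg ge; have e0 : 0 <= e.
  by apply: le_trans (ge a _) => //; rewrite /D/= in_itv/= lexx.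
have m0 : mixture_mean (fun=> 0) = 0.
  rewrite /mixture_mean; under eq_Rintegral do rewrite mulr0.
  by rewrite Rintegral_cst// mul0r.
rewrite -[X in `|X|]subr0 -m0; apply: (mixture_mean_dist (cg := e) (ch := 0)) => //.
  by move=> s _; rewrite normr0.
by move=> s Ds; rewrite subr0 ge.
Qed.

Lemma scale_mixtureE mu x :
  scale_mixture mu G x = mixture_mean (fun s => normal_peak 1 * gauss_kernel s (x - mu)).
Proof.
rewrite /scale_mixture unlock /mixture_mean /Rintegral; congr fine.
have m1 : measurable_fun setT (fun s : R => s^-1 * normal_pdf 0 1 ((x - mu) / s)).
  under eq_fun do rewrite normal_pdf01E.
  exact: measurable_normal_kernel.
have m2 : measurable_fun setT (fun s : R =>
    \1_D s * (normal_peak 1 * gauss_kernel s (x - mu))).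
  apply: measurable_funM; first by apply: measurable_indic; exact: measurable_itv.
  exact: measurable_normal_kernel.
apply: ae_eq_integral => //; try exact/measurable_EFinP.
exists (~` D); split => //; first by apply: measurableC; exact: measurable_itv.
apply: subsetC => s Ds _; rewrite normal_pdf01E indicE mem_set//.
by rewrite mul1r.
Qed.

Lemma scale_mixture_ge0 mu x : 0 <= scale_mixture mu G x.
Proof.
rewrite scale_mixtureE; apply: Rintegral_ge0 => s _; rewrite indicE.
case: (boolP (s \in D)) => [/set_mem Ds|_]; last by rewrite mul0r.
by rewrite mul1r mulr_ge0 ?normal_peak_ge0// gauss_kernel_ge0// D0.
Qed.

Lemma normal_kernel_bound s u : D s ->
  `|normal_peak 1 * gauss_kernel s u| <= normal_peak 1 / a.
Proof.
move=> Ds; have s0 := D0 Ds.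
rewrite ger0_norm; last by rewrite mulr_ge0 ?normal_peak_ge0// gauss_kernel_ge0.
rewrite ler_wpM2l ?normal_peak_ge0// /gauss_kernel.
apply: (@le_trans _ _ (s^-1 * 1)).
  rewrite ler_wpM2l ?invr_ge0 ?(ltW s0)// -expR0 ler_expR oppr_le0.
  by rewrite divr_ge0// sqr_ge0.
rewrite mulr1 lef_pV2 ?posrE//.
by move: Ds; rewrite /D/= in_itv/= => /andP[].
Qed.

Let kD mu (p : R * R) : R := \1_D p.1 * (normal_peak 1 * gauss_kernel p.1 (p.2 - mu)).

Let kD_ge0 mu p : 0 <= kD mu p.
Proof.
rewrite /kD indicE;
case: (boolP (p.1 \in D)) => [/set_mem Ds|_]; last by rewrite mul0r.
by rewrite mul1r mulr_ge0 ?normal_peak_ge0// gauss_kernel_ge0// D0.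
Qed.

Let measurable_kD mu :
  measurable_fun [set: measurableTypeR R * measurableTypeR R] (kD mu).
Proof.
apply: measurable_funM.
  by apply: measurableT_comp => //; apply: measurable_indic; exact: measurable_itv.
apply: measurable_funM => //.
apply: (@measurable_gauss_kernel _ (measurableTypeR R * measurableTypeR R)%type
  R fst (fun p => p.2 - mu)) => //.
by apply: measurable_funB.
Qed.

Let scale_mixtureEFin mu x :
  (scale_mixture mu G x)%:E = (\int[G]_s (kD mu (s, x))%:E)%E.
Proof.
rewrite scale_mixtureE /mixture_mean /Rintegral fineK//.
apply: integrable_fin_num => //.
apply: (@integrable_restrict_bounded _ (normal_peak 1 / a)).
  exact: measurable_normal_kernel.
by move=> s Ds; exact: normal_kernel_bound.
Qed.

Lemma measurable_scale_mixture mu : measurable_fun setT (scale_mixture mu G).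
Proof.
apply/measurable_EFinP.
rewrite (_ : EFin \o _ = fubini_G G (EFin \o kD mu)).
  apply: measurable_fun_fubini_tonelli_G.
  - by apply/measurable_EFinP; exact: measurable_kD.
  - by move=> x /=; rewrite lee_fin; exact: kD_ge0.
by apply/funext => x; rewrite /= scale_mixtureEFin.
Qed.

(** By Tonelli, as every normal density has integral 1. *)
Lemma integral_scale_mixture mu :
  (\int[@lebesgue_measure R]_x (scale_mixture mu G x)%:E = 1)%E.
Proof.
under eq_integral do rewrite scale_mixtureEFin.
rewrite -(@fubini_tonelli _ _ _ _ R G (@lebesgue_measure R) (EFin \o kD mu));
  first last.
- by move=> x /=; rewrite lee_fin; exact: kD_ge0.
- by apply/measurable_EFinP; exact: measurable_kD.
transitivity (\int[G]_s (\1_D s)%:E)%E; last first.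
  by rewrite integral_indic ?setIT ?GD//; exact: measurable_itv.
apply: eq_integral => s _ /=; rewrite /kD/= indicE.
case: (boolP (s \in D)) => [/set_mem Ds|_]; last first.
  by under eq_integral do rewrite mul0r; rewrite integral0.
under eq_integral do rewrite mul1r -normal_pdf_gauss_kernel ?D0//.
by rewrite integral_normal_pdf.
Qed.

End mixture.

(** * Localization of the centre *)

Lemma scale_mixture_tail (R : realType) (a b q L mu x : R)
  (G : probability (measurableTypeR R) R) :
  0 < a -> a <= b -> supp G `<=` `[a, b]%classic -> 0 <= q -> 1 <= L ->
  expR (- (4 * L)) <= q * a / (2 * b) -> 4 * L * b <= `|x - mu| ->
  scale_mixture mu G x <= q * normal_pdf mu (2 * b) x.
Proof.
move=> a0 ab Gab q0 L1 key xL.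
have b0 : 0 < b by apply: lt_le_trans ab.
rewrite normal_pdf_gauss_kernel ?mulr_gt0// (scale_mixtureE Gab).
apply: le_trans (ler_norm _) _; apply: (@mixture_mean_norm_le _ a b G ab).
  exact: measurable_normal_kernel.
move=> s; rewrite /= in_itv/= => /andP[as_ sb].
have s0 : 0 < s by apply: lt_le_trans as_.
rewrite ger0_norm; last by rewrite mulr_ge0 ?normal_peak_ge0// gauss_kernel_ge0.
rewrite [leRHS]mulrCA ler_wpM2l ?normal_peak_ge0//.
apply: (gauss_kernel_tail a0 as_ sb q0 key).
have xb : 4 * L <= `|(x - mu) / b|.
  by rewrite normrM normfV (gtr0_norm b0) ler_pdivlMr.
have := sqr_div_le (x - mu) s0 sb.
have : (4 * L) ^+ 2 <= ((x - mu) / b) ^+ 2.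
  by rewrite -[leRHS]real_normK ?num_real// lerXn2r// ?nnegrE ?mulr_ge0//; lra.
nra.
Qed.

(** Square sqrt u = sqrt v + (sqrt u - sqrt v).  Pointwise, this turns smallness of
    v and of the Hellinger integrand into smallness of u. *)
Lemma le_sqrt_dist (R : realType) (u v : R) : 0 <= u -> 0 <= v ->
  u <= 2 * v + 2 * (Num.sqrt u - Num.sqrt v) ^+ 2.
Proof.
move=> u0 v0; rewrite -{1}(sqr_sqrtr u0) -{1}(sqr_sqrtr v0).
move: (Num.sqrt u) (Num.sqrt v) => c d.
have := sqr_ge0 (c - 2 * d); nra.
Qed.

Lemma measurable_sqrtr d (T : measurableType d) (R : realType) (f : T -> R) :
  measurable_fun setT f -> measurable_fun setT (fun t => Num.sqrt (f t)).
Proof.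
move=> mf; apply: measurableT_comp mf.
by apply: continuous_measurable_fun; exact: sqrt_continuous.
Qed.

Lemma hellinger_le_sqr (R : realType) (f g : R -> R) (r : R) : 0 <= r ->
  (hellinger f g <= r%:E)%E ->
  (\int[@lebesgue_measure R]_x (((Num.sqrt (f x) - Num.sqrt (g x)) ^+ 2)%:E)
   <= (r ^+ 2)%:E)%E.
Proof.
move=> r0; rewrite /hellinger => H; rewrite -lee_sqrt ?lee_fin ?sqr_ge0//.
by rewrite [(r ^+ 2)%:E]EFin_expe sqrte_sqr gee0_abs// lee_fin.
Qed.

(** If the centres are further apart than 8 L b, every x is at distance at least
    4 L b from one of them, where the corresponding density is negligible.  Hence
    everywhere f <= q g + 2 q g0 + 2 (sqrt f - sqrt f0)^2 with normal densities g
    and g0: integrating, 1 <= 3 q + 2 / 64, which is false. *)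
Lemma localized_location (R : realType) (a b q L mu mu0 : R)
  (G G0 : probability (measurableTypeR R) R) :
  0 < a -> a <= b -> supp G `<=` `[a, b]%classic -> supp G0 `<=` `[a, b]%classic ->
  0 <= q -> q <= 8^-1 -> 1 <= L ->
  expR (- (4 * L)) <= q * a / (2 * b) ->
  (hellinger (scale_mixture mu G) (scale_mixture mu0 G0) <= 8^-1%:E)%E ->
  `|mu - mu0| <= 8 * L * b.
Proof.
move=> a0 ab Gab G0ab q0 q1 L1 key H; rewrite leNgt; apply/negP => far.
have b0 : 0 < b by apply: lt_le_trans ab.
set f := scale_mixture mu G in H *; set f0 := scale_mixture mu0 G0 in H *.
pose D2 x := (Num.sqrt (f x) - Num.sqrt (f0 x)) ^+ 2.
have f_ge0 x : 0 <= f x by exact: (scale_mixture_ge0 a0 Gab).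
have f0_ge0 x : 0 <= f0 x by exact: (scale_mixture_ge0 a0 G0ab).
have mf : measurable_fun setT f := measurable_scale_mixture a0 ab Gab mu.
have mf0 : measurable_fun setT f0 := measurable_scale_mixture a0 ab G0ab mu0.
have mD2 : measurable_fun setT D2.
  by apply: measurable_funX; apply: measurable_funB; exact: measurable_sqrtr.
have D20 x : 0 <= D2 x by exact: sqr_ge0.
have g0 m x : 0 <= normal_pdf m (2 * b) x :> R by exact: normal_pdf_ge0.
have ptw x : f x <= q * normal_pdf mu (2 * b) x
    + (2 * q) * normal_pdf mu0 (2 * b) x + 2 * D2 x.
  have [xm|xm] := leP (4 * L * b) `|x - mu|.
    have := scale_mixture_tail a0 ab Gab q0 L1 key xm.
    rewrite -/f => h; apply: (le_trans h); rewrite -addrA lerDl.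
    by apply: addr_ge0; apply: mulr_ge0 => //; exact: mulr_ge0.
  have xm0 : 4 * L * b <= `|x - mu0|.
    have := ler_distD x mu mu0; rewrite (distrC mu x); lra.
  have := scale_mixture_tail a0 ab G0ab q0 L1 key xm0; rewrite -/f0 => h.
  apply: (le_trans (le_sqrt_dist (f_ge0 x) (f0_ge0 x))).
  rewrite -/(D2 x) lerD2r.
  apply: (@le_trans _ _ (2 * q * normal_pdf mu0 (2 * b) x)).
    by rewrite -mulrA ler_wpM2l.
  by rewrite lerDr mulr_ge0.
have := integral_scale_mixture a0 ab Gab mu; rewrite -/f => f1.
have : (\int[@lebesgue_measure R]_x (f x)%:E <=
   \int[@lebesgue_measure R]_x ((q * normal_pdf mu (2 * b) x)%:E +
      (2 * q * normal_pdf mu0 (2 * b) x)%:E + (2 * D2 x)%:E))%E.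
  apply: ge0_le_integral => //.
  - by move=> x _; rewrite lee_fin.
  - exact/measurable_EFinP.
  - apply: emeasurable_funD; first apply: emeasurable_funD; apply/measurable_EFinP;
      by apply: measurable_funM => //; exact: measurable_normal_pdf.
  - by move=> x _; rewrite -!EFinD lee_fin.
have mn c m : measurable_fun setT (fun x => (c * normal_pdf m (2 * b) x)%:E).
  by apply/measurable_EFinP; apply: measurable_funM => //; exact: measurable_normal_pdf.
have i1 c m : 0 <= c ->
    (\int[@lebesgue_measure R]_x (c * normal_pdf m (2 * b) x)%:E = c%:E)%E.
  move=> c0; under eq_integral do rewrite EFinM.
  rewrite ge0_integralZl_EFin//;
    last by apply/measurable_EFinP; exact: measurable_normal_pdf.
    by rewrite integral_normal_pdf mule1.
  by move=> x _; rewrite lee_fin.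
have n0 c m x : 0 <= c -> (0 <= (c * normal_pdf m (2 * b) x)%:E)%E.
  by move=> c0; rewrite lee_fin mulr_ge0.
have q20 : 0 <= 2 * q by rewrite mulr_ge0.
have mD : measurable_fun setT (fun x => (2 * D2 x)%:E).
  by apply/measurable_EFinP; apply: measurable_funM.
rewrite (ge0_integralD _ measurableT); first last.
- exact: mD.
- by move=> x _; rewrite lee_fin mulr_ge0.
- by apply: emeasurable_funD; exact: mn.
- by move=> x _; rewrite adde_ge0// n0.
rewrite (ge0_integralD _ measurableT); first last.
- exact: mn.
- by move=> x _; exact: n0.
- exact: mn.
- by move=> x _; exact: n0.
rewrite !i1 ?mulr_ge0//.
under [X in (_ + X)%E]eq_integral do rewrite EFinM.
rewrite ge0_integralZl_EFin//; first last.
- exact/measurable_EFinP.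
- by move=> x _; rewrite lee_fin.
have HI : (\int[@lebesgue_measure R]_x (D2 x)%:E <= (8^-1 ^+ 2)%:E)%E.
  by apply: hellinger_le_sqr H; rewrite invr_ge0.
rewrite f1 => h1.
have : (1 <= (q + 2 * q + 2 * 8^-1 ^+ 2)%:E)%E.
  apply: (le_trans h1); rewrite !EFinD EFinM leeD2l// EFinM.
  by apply: lee_wpmul2l => //; rewrite lee_fin.
rewrite lee_fin; lra.
Qed.

(** * Finite expansions of the mixtures *)

Lemma measurable_scale_coef (R : realType) (a : R) (k j : nat) :
  measurable_fun setT (scale_coef a k j).
Proof.
apply: measurable_funM; first by apply: measurable_indic; exact: measurable_itv.
by apply: measurable_funX; apply: measurable_funM => //; exact: measurable_invr.
Qed.

Lemma measurable_taylor_atom (R : realType) (w a m : R) (k j : nat) :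
  measurable_fun setT (fun x : R => taylor_atom w a k j (x - m)).
Proof.
have mB : measurable_fun setT (fun x : R => x - m) by apply: measurable_funB.
apply: measurable_fun_ifT => //.
  by apply: measurable_fun_ler => //; exact: measurable_funX.
apply: measurable_funM => //; apply: measurable_funM => //.
apply: measurable_funX; apply: measurableT_comp => //; apply: measurable_funM => //.
by apply: measurable_funX; exact: measurable_funM.
Qed.

Lemma mixture_mean_itv (R : realType) (a b : R)
  (G : probability (measurableTypeR R) R) (g : R -> R) :
  a <= b -> measurable_fun setT g -> (forall s, 0 <= g s <= 1) ->
  0 <= mixture_mean a b G g <= 1.
Proof.
move=> ab mg g01; have g1 s : `[a, b]%classic s -> `|g s| <= 1.
  by move=> _; have /andP[g0 ?] := g01 s; rewrite ger0_norm.
apply/andP; split.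
  apply: Rintegral_ge0 => s _; rewrite mulr_ge0//.
  by have /andP[] := g01 s.
by apply: le_trans (ler_norm _) _; exact: (@mixture_mean_norm_le _ a b G ab).
Qed.

Lemma mixture_mean_sum (R : realType) (a b : R)
  (G : probability (measurableTypeR R) R)
  (I : Type) (r : seq I) (g : I -> R -> R) (w : I -> R) :
  a <= b -> (forall i, measurable_fun setT (g i)) -> (forall i s, 0 <= g i s <= 1) ->
  mixture_mean a b G (fun s => \sum_(i <- r) g i s * w i) =
  \sum_(i <- r) mixture_mean a b G (g i) * w i.
Proof.
move=> ab mg g01.
have g1 i s : `|g i s| <= 1 by have /andP[? ?] := g01 i s; rewrite ger0_norm.
elim: r => [|i r IH].
  rewrite /mixture_mean; under eq_Rintegral do rewrite big_nil mulr0.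
  by rewrite Rintegral_cst// mul0r big_nil.
rewrite big_cons -IH /mixture_mean -RintegralZr//; last first.
  by apply: (@integrable_restrict_bounded _ _ _ _ ab _ 1) => // s _; exact: g1.
rewrite -RintegralD//.
- by apply: eq_Rintegral => s _; rewrite big_cons mulrDr mulrA.
- under [X in _.-integrable _ (_ \o X)]eq_fun do rewrite -mulrA.
  apply: (@integrable_restrict_bounded _ _ _ _ ab _ `|w i|).
    exact: measurable_funM.
  by move=> s _; rewrite normrM ler_piMl.
- apply: (@integrable_restrict_bounded _ _ _ _ ab _ (\sum_(i <- r) `|w i|)).
    by apply: measurable_sum => k; exact: measurable_funM.
  move=> s _; apply: (le_trans (ler_norm_sum _ _ _)); apply: ler_sum => k _.
  by rewrite normrM ler_piMl.
Qed.

Definition mixture_expansion (R : realType) (w a : R) (K n : nat)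
    (c : 'I_K * 'I_n -> R) (u : R) : R :=
  normal_peak 1 * \sum_p c p * taylor_atom w a p.1 p.2 u.

(** The pointwise estimates of the kernel hold for every scale s in [a, b] with the
    same envelope, so they survive averaging.  One q pays for the shift of the
    centre, the other for the expansion. *)
Lemma mixture_expansion_approx (R : realType) (a b q L h mu m x : R) (n : nat)
  (G : probability (measurableTypeR R) R) :
  0 < a -> a <= b -> supp G `<=` `[a, b]%classic -> 0 <= q -> q <= 1 -> 0 <= L ->
  expR (- (4 * L)) <= q * a / (2 * b) -> 412 * L <= n%:R ->
  16 * b * h <= q * a ^+ 2 -> `|mu - m| <= h ->
  `|scale_mixture mu G x
    - mixture_expansion (192 * L) a
        (fun p : 'I_(scale_pieces a b) * 'I_n =>
           mixture_mean a b G (scale_coef a p.1 p.2)) (x - m)|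
  <= 2 * q * normal_pdf m (2 * b) x.
Proof.
move=> a0 ab Gab q0 q1 L0 key Ln hh muh.
have b0 : 0 < b by apply: lt_le_trans ab.
rewrite (scale_mixtureE Gab) normal_pdf_gauss_kernel ?mulr_gt0//.
rewrite /mixture_expansion mulr_sumr.
under eq_bigr do rewrite mulrCA.
rewrite -(@mixture_mean_sum _ a b G _ _
   (fun p : 'I_(scale_pieces a b) * 'I_n => scale_coef a p.1 p.2)
   (fun p => normal_peak 1 * taylor_atom (192 * L) a p.1 p.2 (x - m))) //; first last.
- by move=> p s; exact: scale_coef_itv.
- by move=> p; exact: measurable_scale_coef.
have gk0 : 0 <= gauss_kernel (2 * b) (x - m).
  by apply: gauss_kernel_ge0; rewrite mulr_gt0.
have pk0 := @normal_peak_ge0 R 1.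
apply: (@mixture_mean_dist _ a b G ab _ _ (normal_peak 1 / a)
   (\sum_(p : 'I_(scale_pieces a b) * 'I_n)
      `|normal_peak 1 * taylor_atom (192 * L) a p.1 p.2 (x - m)|)).
- exact: measurable_normal_kernel.
- by move=> s Ds; exact: normal_kernel_bound Ds.
- apply: measurable_sum => p; apply: measurable_funM => //.
  exact: measurable_scale_coef.
- move=> s _; apply: (le_trans (ler_norm_sum _ _ _)); apply: ler_sum => p _.
  have /andP[c0 c1] := scale_coef_itv s p.1 p.2 a0.
  by rewrite normrM ler_piMl// ger0_norm.
- by apply: mulr_ge0; apply: mulr_ge0.
move=> s; rewrite /= in_itv/= => /andP[as_ sb].
under eq_bigr do rewrite mulrCA.
rewrite -mulr_sumr -mulrBr normrM (ger0_norm pk0) [leRHS]mulrCA ler_wpM2l//.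
have h1 := gauss_kernel_shift (x - m) a0 as_ sb q0 q1 hh muh.
have h2 := kernel_expansion (x - m) a0 as_ sb q0 L0 key Ln.
rewrite pair_bigA/= in h2.
have -> : x - mu = x - m - (mu - m) by ring.
apply: (le_trans (ler_distD (gauss_kernel s (x - m)) _ _)).
apply: (le_trans (lerD h1 h2)).
lra.
Qed.

Lemma mixture_expansion_rounding (R : realType) (a b q L u : R) (n M : nat) :
  0 < a -> a <= b -> 0 <= q -> 0 <= L -> expR (- (4 * L)) <= q * a / (2 * b) ->
  (scale_pieces a b)%:R * expR (124 * L) <= M%:R ->
  forall c c' : 'I_(scale_pieces a b) * 'I_n -> R,
  (forall p, `|c p - c' p| <= M%:R^-1) ->
  `|mixture_expansion (192 * L) a c u - mixture_expansion (192 * L) a c' u|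
   <= q * (normal_peak 1 * gauss_kernel (2 * b) u).
Proof.
move=> a0 ab q0 L0 key hM c c' cc.
rewrite /mixture_expansion -mulrBr normrM (ger0_norm (normal_peak_ge0 _)).
rewrite [leRHS]mulrCA ler_wpM2l ?normal_peak_ge0//.
apply: le_trans (taylor_atom_sum u n a0 ab q0 L0 key hM).
rewrite pair_bigA/= mulr_sumr -sumrB.
apply: (le_trans (ler_norm_sum _ _ _)); apply: ler_sum => p _.
by rewrite -mulrBl normrM ler_wpM2r.
Qed.

(** * From approximants to brackets *)

Lemma sqr_sqrt_dist_le (R : realType) (l u : R) : 0 <= l -> l <= u ->
  (Num.sqrt l - Num.sqrt u) ^+ 2 <= u - l.
Proof.
move=> l0 lu; have u0 := le_trans l0 lu.
rewrite -{2}(sqr_sqrtr l0) -{2}(sqr_sqrtr u0).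
have := sqrtr_ge0 l; have : Num.sqrt l <= Num.sqrt u by rewrite ler_sqrt.
move: (Num.sqrt l) (Num.sqrt u) => c d; nra.
Qed.

(** The brackets are A t minus and plus the envelope, cut off at 0.  Their width is
    at most eps^2 times a probability density, and
    (sqrt u - sqrt l)^2 <= u - l. *)
Lemma bracket_cover_of_approx (R : realType) (eps s : R) (Q : set (R -> R))
  (T : finType) (A : T -> R -> R) (m : T -> R) :
  0 <= eps -> (forall t, measurable_fun setT (A t)) ->
  (forall f, Q f -> (forall x, 0 <= f x) /\
     exists t, forall x, `|f x - A t x| <= eps ^+ 2 / 2 * normal_pdf (m t) s x) ->
  bracket_cover eps Q #|T|.
Proof.
move=> e0 mA cov.
pose E t x := eps ^+ 2 / 2 * normal_pdf (m t) s x.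
have E0 t x : 0 <= E t x by rewrite mulr_ge0 ?normal_pdf_ge0// divr_ge0// sqr_ge0.
have mE t : measurable_fun setT (E t).
  by apply: measurable_funM => //; exact: measurable_normal_pdf.
pose lo t x := Num.max 0 (A t x - E t x).
pose up t x := Num.max 0 (A t x + E t x).
have mlo t : measurable_fun setT (lo t).
  by apply: measurable_maxr => //; exact: measurable_funB.
have mup t : measurable_fun setT (up t).
  by apply: measurable_maxr => //; exact: measurable_funD.
have lo0 t x : 0 <= lo t x by rewrite le_max lexx.
have up0 t x : 0 <= up t x by rewrite le_max lexx.
have loup t x : lo t x <= up t x.
  rewrite /lo /up ge_max le_max lexx/= le_max; apply/orP; right.
  by have := E0 t x; lra.
have uplo t x : up t x - lo t x <= eps ^+ 2 * normal_pdf (m t) s x.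
  have -> : eps ^+ 2 * normal_pdf (m t) s x = 2 * E t x by rewrite /E; field.
  rewrite /up /lo; have := E0 t x.
  by case: (ltP 0 (A t x - E t x)) => h1; case: (ltP 0 (A t x + E t x)) => h2; lra.
exists (fun i => lo (enum_val i)), (fun i => up (enum_val i)); split.
- by move=> i; split; split.
- move=> i; move: (enum_val i) => t.
  have -> : eps%:E = sqrte ((eps ^+ 2)%:E) by rewrite EFin_expe sqrte_sqr gee0_abs.
  rewrite /hellinger lee_sqrt ?lee_fin ?sqr_ge0//.
  apply: (@le_trans _ _
    (\int[@lebesgue_measure R]_x (eps ^+ 2 * normal_pdf (m t) s x)%:E)%E).
    apply: ge0_le_integral => //.
    + by move=> x _; rewrite lee_fin sqr_ge0.
    + apply/measurable_EFinP; apply: measurable_funX.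
      by apply: measurable_funB; apply: measurable_sqrtr; [exact: mlo | exact: mup].
    + apply/measurable_EFinP; apply: measurable_funM => //.
      exact: measurable_normal_pdf.
    + move=> x _; rewrite lee_fin; apply: le_trans (uplo t x).
      exact: sqr_sqrt_dist_le.
  under eq_integral do rewrite EFinM.
  rewrite ge0_integralZl_EFin ?sqr_ge0//.
  + by rewrite integral_normal_pdf mule1.
  + by move=> x _; rewrite lee_fin normal_pdf_ge0.
  + by apply/measurable_EFinP; exact: measurable_normal_pdf.
- move=> f Qf; have [f0 [t ft]] := cov f Qf.
  exists (enum_rank t) => x; rewrite enum_rankK.
  have := ft x; rewrite -/(E t x) ler_distl => /andP[h1 h2].
  by rewrite /lo /up ge_max le_max f0 h1 h2 orbT.
Qed.

(** * Counting the approximants *)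

Lemma measurable_mixture_expansion (R : realType) (w a m : R) (K n : nat)
  (c : 'I_K * 'I_n -> R) :
  measurable_fun setT (fun x : R => mixture_expansion w a c (x - m)).
Proof.
apply: measurable_funM => //; apply: measurable_sum => p.
by apply: measurable_funM => //; exact: measurable_taylor_atom.
Qed.

Lemma grid_rounding (R : realType) (N : nat) (h c y : R) : 0 < h ->
  c <= y -> (y - c) / h < N.+1%:R -> exists i : 'I_N.+1, `|y - (c + i%:R * h)| <= h.
Proof.
move=> h0 cy yN.
have z0 : 0 <= (y - c) / h by rewrite divr_ge0 ?subr_ge0// ltW.
have iN : (Num.truncn ((y - c) / h) < N.+1)%N by rewrite truncn_lt_nat.
exists (Ordinal iN) => /=.
have /andP[] := truncn_itv z0; move: (Num.truncn _) => i.
rewrite ler_pdivlMr// ltr_pdivrMr// -natr1 mulrDl mul1r => h1 h2.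
by rewrite ler_norml; apply/andP; split; lra.
Qed.

Lemma ln_ge_three_halves (R : realType) (t : R) : 8 <= t -> 3 / 2 <= ln t.
Proof.
move=> t8; rewrite -[leLHS]expRK ler_ln ?posrE ?expR_gt0//; last by lra.
apply: le_trans t8; rewrite expRM_natl (_ : 8 = 2 ^+ 3); last by ring.
by rewrite lerXn2r ?nnegrE ?expR_ge0// expR_half_le2.
Qed.

(** The covering for arbitrary sizes of the grids: Ng + 1 centres at mesh h from
    mu0 - 8 L b on, and for each coefficient the multiples of 1 / M in [0, 1].
    Here 3 q = eps^2 / 2: two q come from [mixture_expansion_approx], one from the
    rounding. *)
Lemma localized_cover (R : realType) (a b eps delta L h : R) (n M Ng : nat)
  (f0 : R -> R) :
  0 < a -> a <= b -> scale_mixtures a b f0 -> 0 < eps -> eps <= delta ->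
  delta <= 8^-1 -> 1 <= L ->
  expR (- (4 * L)) <= eps ^+ 2 / 6 * a / (2 * b) -> 412 * L <= n%:R ->
  (0 < M)%N -> (scale_pieces a b)%:R * expR (124 * L) <= M%:R ->
  0 < h -> 16 * b * h <= eps ^+ 2 / 6 * a ^+ 2 -> 16 * L * b / h < Ng.+1%:R ->
  bracket_cover eps (localized (scale_mixtures a b) f0 delta)
    (Ng.+1 * M.+1 ^ (scale_pieces a b * n)).
Proof.
move=> a0 ab [mu0 [G0 [_ G0ab f0E]]] e0 ed d8 L1; subst f0.
set q := eps ^+ 2 / 6; set K := scale_pieces a b => key nL MP MK h0 hh NgL.
have b0 : 0 < b by apply: lt_le_trans ab.
have L0 : 0 <= L by apply: le_trans L1.
have q0 : 0 < q by rewrite divr_gt0 ?exprn_gt0.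
have q8 : q <= 8^-1.
  have e8 : eps <= 8^-1 by apply: le_trans d8.
  by rewrite /q; nra.
have M0 : 0 < M%:R :> R by rewrite ltr0n.
pose T : finType := ('I_Ng.+1 * {ffun 'I_K * 'I_n -> 'I_M.+1})%type.
pose center (i : nat) : R := mu0 - 8 * L * b + i%:R * h.
pose A (t : T) (x : R) := mixture_expansion (192 * L) a
  (fun p => (t.2 p)%:R / M%:R) (x - center t.1).
have <- : #|T| = (Ng.+1 * M.+1 ^ (K * n))%N.
  by rewrite card_prod card_ffun card_prod !card_ord.
apply: (@bracket_cover_of_approx _ eps (2 * b) _ T A (fun t => center t.1)).
- exact: ltW.
- by move=> u; exact: measurable_mixture_expansion.
move=> f [[mu [G [_ Gab ->]]] Hf].
split; first by move=> x; exact: (scale_mixture_ge0 a0 Gab).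
have loc : `|mu - mu0| <= 8 * L * b.
  apply: (localized_location a0 ab Gab G0ab (ltW q0) q8 L1 key).
  by apply: le_trans Hf _; rewrite lee_fin.
have /andP[loc1 loc2] : - (8 * L * b) <= mu - mu0 <= 8 * L * b.
  by rewrite -ler_norml.
have [i Hi] : exists i : 'I_Ng.+1, `|mu - center i| <= h.
  apply: grid_rounding => //; first by lra.
  by apply: le_lt_trans NgL; rewrite ler_pM2r ?invr_gt0//; lra.
pose mean (p : 'I_K * 'I_n) := mixture_mean a b G (scale_coef a p.1 p.2).
have coef p : exists j : 'I_M.+1, `|mean p - j%:R / M%:R| <= M%:R^-1.
  have /andP[c0 c1] := mixture_mean_itv G ab (measurable_scale_coef a p.1 p.2)
    (fun s => scale_coef_itv s p.1 p.2 a0).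
  (* The grid of mesh 1 / M in [0, 1]. *)
  have [|||j Hj] := @grid_rounding R M M%:R^-1 0 (mean p).
  - by rewrite invr_gt0.
  - exact: c0.
  - rewrite subr0 invrK; apply: (@le_lt_trans _ _ M%:R); last by rewrite ltr_nat.
    by rewrite ler_piMl// ltW.
  by exists j; move: Hj; rewrite add0r.
pose c : {ffun 'I_K * 'I_n -> 'I_M.+1} := [ffun p => projT1 (cid (coef p))].
exists (i, c) => x; rewrite /A/=.
have q1 : q <= 1 by apply: le_trans q8 _; lra.
have approx := mixture_expansion_approx x a0 ab Gab (ltW q0) q1 L0 key nL hh Hi.
have round := @mixture_expansion_rounding R a b q L (x - center i) n M
  a0 ab (ltW q0) L0 key MK mean (fun p => (c p)%:R / M%:R).
rewrite -normal_pdf_gauss_kernel ?mulr_gt0// in round.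
have cE (p : 'I_K * 'I_n) : `|mean p - (c p)%:R / M%:R| <= M%:R^-1.
  by rewrite /c ffunE; exact: (projT2 (cid (coef p))).
apply: (le_trans (ler_distD (mixture_expansion (192 * L) a mean (x - center i)) _ _)).
apply: (le_trans (lerD approx (round cE))).
have -> : eps ^+ 2 / 2 = 3 * q by rewrite /q; field.
rewrite -mulrDl; move: (normal_pdf _ _ _) => g.
by have -> : 2 * q + q = 3 * q by ring.
Qed.

Lemma ratio_ge8 (R : realType) (a b eps : R) : 0 < a -> a <= b -> 0 < eps ->
  eps <= 8^-1 -> 8 <= b / (eps * a).
Proof.
move=> a0 ab e0 e8; rewrite ler_pdivlMr ?mulr_gt0//; apply: le_trans ab.
have : 8 * eps * a <= 1 * a by rewrite ler_pM2r//; lra.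
by rewrite mul1r mulrA.
Qed.

(** With grids of the smallest admissible order, each of the O(L^2) coefficients takes
    exp(O(L)) values, and so does the centre. *)
Lemma localized_log_cover (R : realType) (a b eps delta : R) (f0 : R -> R) :
  0 < a -> a <= b -> scale_mixtures a b f0 -> 0 < eps -> eps <= delta ->
  delta <= 8^-1 ->
  exists2 N : nat, bracket_cover eps (localized (scale_mixtures a b) f0 delta) N &
    (0 < N)%N /\ ln N%:R <= 400 * 300 * ln (b / (eps * a)) ^+ 3.
Proof.
move=> a0 ab hf0 e0 ed d8.
have b0 : 0 < b by apply: lt_le_trans ab.
have e8 : eps <= 8^-1 by apply: le_trans d8.
have := ratio_ge8 a0 ab e0 e8.
set t := b / (eps * a) => t8; set L := ln t.
have t0 : 0 < t by apply: lt_le_trans t8.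
have t64 : 64 <= t ^+ 2 by nra.
have L32 : 3 / 2 <= L by exact: ln_ge_three_halves.
have eL : expR L = t by rewrite lnK.
have L0 : 0 <= L by lra.
have L1 : 1 <= L by lra.
have teps : t * eps = b / a by rewrite /t; field; rewrite !gt_eqF.
have ba1 : 1 <= b / a by rewrite ler_pdivlMr// mul1r.
(* As t eps = b / a >= 1, powers of t dominate both b / a and 1 / eps. *)
have key : expR (- (4 * L)) <= eps ^+ 2 / 6 * a / (2 * b).
  rewrite expRN expRM_natl eL.
  have -> : eps ^+ 2 / 6 * a / (2 * b) = (t ^+ 4)^-1 * (t ^+ 2 / 12 * (b / a)).
    by rewrite /t; field; rewrite !gt_eqF.
  rewrite ler_peMr ?invr_ge0 ?exprn_ge0 ?(ltW t0)//.
  by move: (t ^+ 2) t64 => z z64; nra.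
pose h := eps ^+ 2 / 6 * a ^+ 2 / (16 * b).
have h0 : 0 < h by rewrite !divr_gt0 ?mulr_gt0 ?invr_gt0 ?exprn_gt0.
have hh : 16 * b * h <= eps ^+ 2 / 6 * a ^+ 2.
  by rewrite /h mulrC divfK// gt_eqF// mulr_gt0.
pose Ng := Num.truncn (16 * L * b / h).
pose n := (Num.truncn (412 * L)).+1.
have nL : 412 * L <= n%:R by apply: ltW; exact: truncnS_gt.
set K := scale_pieces a b.
pose M := (Num.truncn (K%:R * expR (124 * L))).+1.
have MK : K%:R * expR (124 * L) <= M%:R by apply: ltW; exact: truncnS_gt.
have cov := localized_cover a0 ab hf0 e0 ed d8 L1 key nL (ltn0Sn _) MK h0 hh
  (truncnS_gt _).
exists (Ng.+1 * M.+1 ^ (K * n))%N; first exact: cov.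
split; first by rewrite muln_gt0/= expn_gt0.
have KL : K%:R <= L + 1.
  rewrite /K /scale_pieces -natr1 lerD2r.
  apply: (@le_trans _ _ (ln (b / a))); first by rewrite truncn_le// ln_ge0.
  rewrite ler_ln ?posrE ?(lt_le_trans ltr01 ba1)//.
  by rewrite -teps ler_piMr ?(ltW t0)//; lra.
have nL2 : n%:R <= 412 * L + 1.
  by rewrite /n -natr1 lerD2r truncn_le ?mulr_ge0 ?ler0n.
have lnM1 : ln M.+1%:R <= 126 * L.
  rewrite -[leRHS]expRK ler_ln ?posrE ?expR_gt0 ?ltr0n//.
  have M1 : M%:R <= K%:R * expR (124 * L) + 1.
    by rewrite /M -natr1 lerD2r truncn_le// mulr_ge0 ?expR_ge0.
  rewrite -natr1.
  have -> : 126 * L = L + L + 124 * L by ring.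
  rewrite !expRD.
  have LE := expR_ge1Dx L.
  have E1 : 1 <= expR (124 * L) by rewrite -[leLHS]expR0 ler_expR mulr_ge0.
  have : K%:R * expR (124 * L) <= expR L * expR (124 * L).
    by rewrite ler_wpM2r ?expR_ge0//; lra.
  have : (8 * expR L) * expR (124 * L) <= (expR L * expR L) * expR (124 * L).
    by rewrite ler_wpM2r ?expR_ge0// ler_wpM2r ?expR_ge0// eL.
  have : 1 * 1 <= expR L * expR (124 * L) by apply: ler_pM => //; lra.
  by lra.
have lnG : ln Ng.+1%:R <= 8 * L.
  rewrite -[leRHS]expRK ler_ln ?posrE ?expR_gt0 ?ltr0n// expRM_natl eL.
  have Ng1 : Ng.+1%:R <= 16 * L * b / h + 1.
    rewrite /Ng -natr1 lerD2r truncn_le// divr_ge0 ?(ltW h0)//.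
    by rewrite !mulr_ge0// ltW.
  (* The mesh h has b / h = 96 t^2. *)
  have hE : 16 * L * b / h = 16 * 96 * L * t ^+ 2.
    by rewrite /h /t; field; rewrite !gt_eqF.
  have Lt : L <= t by rewrite -eL; have := expR_ge1Dx L; lra.
  have t4 : 64 * 64 <= t ^+ 4.
    by rewrite (exprM t 2 2) expr2; apply: ler_pM; rewrite ?ler0n.
  have t7 : 16 * 96 * L * t ^+ 2 <= t ^+ 7.
    have -> : t ^+ 7 = t ^+ 4 * t * t ^+ 2 by ring.
    rewrite ler_wpM2r ?sqr_ge0//; apply: ler_pM => //; lra.
  have t71 : 1 <= t ^+ 7 by rewrite exprn_ege1//; lra.
  have -> : t ^+ 8 = t * t ^+ 7 by ring.
  have : 8 * t ^+ 7 <= t * t ^+ 7 by rewrite ler_wpM2r//; lra.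
  rewrite hE in Ng1; lra.
have posr (k : nat) : (0 < k)%N -> k%:R \in @Num.pos R by rewrite posrE ltr0n.
rewrite natrM lnM ?posr//; last by rewrite expn_gt0.
rewrite natrX lnXn ?ltr0n// -[X in _ + X]mulr_natl natrM.
(* At most 2 L pieces, 414 L terms on each, exp(126 L) values per coefficient. *)
have Kn : K%:R * n%:R <= (2 * L) * (414 * L) by apply: ler_pM => //; lra.
have KnM : K%:R * n%:R * ln M.+1%:R <= (2 * L) * (414 * L) * (126 * L).
  by apply: ler_pM => //; rewrite ?mulr_ge0 ?ln_ge0// ler1n.
have L2 : 1 <= L ^+ 2 by rewrite exprn_ege1.
have L3 : L <= L ^+ 3 by rewrite exprS ler_peMr.
have -> : 400 * 300 * L ^+ 3
    = (2 * L) * (414 * L) * (126 * L) + (400 * 300 - 2 * 414 * 126) * L ^+ 3.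
  by ring.
have : 8 * L ^+ 3 <= (400 * 300 - 2 * 414 * 126) * L ^+ 3.
  by rewrite ler_wpM2r ?exprn_ge0//; lra.
lra.
Qed.

Theorem theorem3p3 (R : realType) :
  exists C : R, 0 < C /\
    forall (smin smax : R), 0 < smin -> smin <= smax ->
    forall f0 : R -> R, scale_mixtures smin smax f0 ->
    forall eps delta : R, 0 < eps -> eps <= delta -> delta <= 8%:R^-1 ->
      (lne (bracketing_number eps (localized (scale_mixtures smin smax) f0 delta))
       <= (C * ln (smax / (eps * smin)) ^+ 3
             * ln (ln (smax / (eps * smin))) ^+ 4)%:E)%E.
Proof.
exists (81 * (400 * 300)); split=> [|a b a0 ab f0 hf0 eps delta e0 ed d8].
  by rewrite !mulr_gt0 ?ltr0n.
have [N cov [N0 lnN]] := localized_log_cover a0 ab hf0 e0 ed d8.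
have t8 := ratio_ge8 a0 ab e0 (le_trans ed d8).
set L := ln (b / (eps * a)) in lnN *.
have L32 : 3 / 2 <= L by exact: ln_ge_three_halves.
have lnL : 3^-1 <= ln L.
  apply: (@le_trans _ _ (ln (3 / 2))); last by rewrite ler_ln ?posrE//; lra.
  (* 3 / 2 is the inverse of 1 - 1 / 3, and ln (1 - 1 / 3) <= - 1 / 3. *)
  have -> : 3 / 2 = (1 - 3^-1)^-1 :> R by field.
  rewrite lnV ?posrE; last by lra.
  have := @le_ln1Dx R (- 3^-1); lra.
have lnL4 : 81^-1 <= ln L ^+ 4.
  rewrite (_ : 81^-1 = 3^-1 ^+ 4); last by field.
  by rewrite lerXn2r ?nnegrE//; lra.
have bN : (bracketing_number eps (localized (scale_mixtures a b) f0 delta)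
    <= N%:R%:E)%E.
  by apply: ereal_inf_lbound; exists N.
have b0 : (0 <= bracketing_number eps (localized (scale_mixtures a b) f0 delta))%E.
  by apply: le_ereal_inf_tmp => _ [k _ <-]; rewrite lee_fin.
apply: (@le_trans _ _ (lne N%:R%:E)).
  by rewrite lee_lne ?in_itv/= ?b0 ?leey ?lee_fin ?ler0n.
rewrite lne_EFin ?ltr0n// lee_fin; apply: (le_trans lnN).
have L30 : 0 <= L ^+ 3 by rewrite exprn_ge0//; lra.
have -> : 81 * (400 * 300) * L ^+ 3 * ln L ^+ 4
    = 400 * 300 * L ^+ 3 * (81 * ln L ^+ 4) by ring.
apply: ler_peMr.
  by apply: mulr_ge0 _ L30; rewrite mulr_ge0 ?ler0n.
by rewrite mulrC -ler_pdivrMr ?ltr0n// mul1r.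
Qed.
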